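(* Let $M, N$ be positive integers and let $k \geq 1$ be an integer (the number of colors). Then $$\sum_{n \ge 0}\ \sum_{\vec{t}} p_{M \times N} (\vec{t};n)\, x_1^{t_1} \cdots x_k^{t_k} q^n = \sum_{r=0}^{\min(M,N)} (x_1 + \cdots + x_k)^r f_{(M \times N; r)}(q),$$ where $\vec{t}=(t_1,\dots,t_k)$ runs over all nonnegative integer vectors in ${\mathbb{Z}_{\geq 0}}^k$, $p_{M\times N}(\vec{t};n)$ is the number of $(k,1)$-colored partitions of $n$ with at most $N$ parts, all of size at most $M$, in which exactly $t_i$ part sizes are of color $i$ for each $i=1,\dots,k$, and $f_{(M \times N; r)}(q)$ is the generating function for partitions in the $M \times N$ box with exactly $r$ different part sizes.
   Context: A $(k,1)$-colored partition of $n$ is a partition of $n$ in which each part is assigned one of $k$ colors, such that all parts of the same size have the same color (only one color is chosen per size of part). A partition lies in the $M \times N$ box if it has at most $N$ parts, each of size at most $M$. The generating function $f_{(M\times N;r)}(q)$ is $\sum_{\lambda} q^{|\lambda|}$, the sum being over all (uncolored) partitions $\lambda$ in the $M\times N$ box having exactly $r$ distinct part sizes, where $|\lambda|$ is the sum of the parts of $\lambda$; the empty partition has $r=0$. *)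

(* Defs.v *)
From mathcomp Require Import all_boot all_order all_algebra.
From mathcomp Require Import boolp classical_sets functions cardinality fsbigop.
From mathcomp Require Import mpoly.

Set Implicit Arguments.
Unset Strict Implicit.
Unset Printing Implicit Defensive.

Import GRing.Theory.
Local Open Scope ring_scope.

Definition is_partition (s : seq nat) : bool :=
  sorted geq s && all (fun a => 0 < a)%N s.

Definition in_box (M N : nat) (s : seq nat) : bool :=
  (size s <= N)%N && all (fun a => a <= M)%N s.

Definition nb_sizes (s : seq nat) : nat := size (undup s).

(* A coloured part is a pair (size, colour). As parts of equal size must share
   their colour, a coloured partition has exactly one listing by nonincreasing
   size, so counting listings counts coloured partitions. *)
Definition is_k1_colored (k : nat) (s : seq (nat * 'I_k)) : bool :=
  is_partition (unzip1 s) &&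
  all2rel (fun a b => (a.1 == b.1) ==> (a.2 == b.2)) s.

Definition nb_sizes_of_color (k : nat) (s : seq (nat * 'I_k)) (i : 'I_k) : nat :=
  nb_sizes [seq a.1 | a <- s & a.2 == i].

(* Finite types encoding the lists of parts, resp. coloured parts, that fit in
   the M x N box (parts equal to 0 are excluded later, by [is_partition]); see [box_parts_onto] and [box_cparts_onto]. *)
Notation box_list M N := {bseq N of 'I_M.+1}.
Notation box_clist M N k := {bseq N of ('I_M.+1 * 'I_k)%type}.

Definition parts (M N : nat) (s : box_list M N) : seq nat :=
  [seq val a | a <- s].

Definition cparts (M N k : nat) (s : box_clist M N k) : seq (nat * 'I_k) :=
  [seq (val a.1, a.2) | a <- s].

Definition p_box (M N k : nat) (t : {ffun 'I_k -> nat}) (n : nat) : nat :=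
  #|[set s : box_clist M N k |
      [&& is_k1_colored (cparts s),
          sumn (unzip1 (cparts s)) == n
        & [forall i, nb_sizes_of_color (cparts s) i == t i]]]|.

Definition f_box (R : nzRingType) (M N r : nat) : {poly R} :=
  \sum_(s : box_list M N | is_partition (parts s) && (nb_sizes (parts s) == r))
    'X^(sumn (parts s)).

Lemma parts_inj (M N : nat) : injective (@parts M N).
Proof. by move=> s u /(inj_map val_inj) /val_inj. Qed.

Lemma cparts_inj (M N k : nat) : injective (@cparts M N k).
Proof.
move=> s u /inj_map h; apply/val_inj/h => -[a i] [b j] /= [ab ->].
by congr (_, _); apply: val_inj.
Qed.

Lemma box_parts_onto (M N : nat) (s : seq nat) :
  in_box M N s <-> exists u : box_list M N, parts u = s.
Proof.
split=> [/andP[sN /allP sM]|[u <-]]; last first.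
  rewrite /in_box size_map size_bseq /=.
  by apply/allP => _ /mapP[a _ ->]; rewrite -ltnS ltn_ord.
have sz : (size [seq inord a : 'I_M.+1 | a <- s] <= N)%N by rewrite size_map.
exists (Bseq sz); rewrite /parts /= -map_comp -[RHS]map_id.
by apply/eq_in_map => a /sM aM /=; rewrite inordK.
Qed.

Lemma box_cparts_onto (M N k : nat) (s : seq (nat * 'I_k)) :
  in_box M N (unzip1 s) <-> exists u : box_clist M N k, cparts u = s.
Proof.
split=> [/andP[sN /allP sM]|[u <-]]; last first.
  rewrite /in_box !size_map size_bseq /= /unzip1 /cparts -map_comp.
  by apply/allP => _ /mapP[a _ ->] /=; rewrite -ltnS ltn_ord.
rewrite size_map in sN.
have sz : (size [seq (inord a.1 : 'I_M.+1, a.2) | a <- s] <= N)%N.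
  by rewrite size_map.
exists (Bseq sz); rewrite /cparts /= -map_comp -[RHS]map_id.
apply/eq_in_map => -[a i] ai /=; rewrite inordK //.
by rewrite ltnS; apply: sM; apply/mapP; exists (a, i).
Qed.

Lemma p_box_gt0 (M N k : nat) (t : {ffun 'I_k -> nat}) (n : nat) :
  (0 < p_box M N t n)%N -> exists s : box_clist M N k,
    n = sumn (unzip1 (cparts s)) /\
    t = [ffun i => nb_sizes_of_color (cparts s) i].
Proof.
case/card_gt0P => s; rewrite inE => /and3P[_ /eqP <- /forallP ts].
by exists s; split=> //; apply/ffunP => i; rewrite ffunE (eqP (ts i)).
Qed.

(* The sums \sum_(i \in setT) of fsbigop are 0 on families of infinite support;
   the next two lemmas show that those over n and over t have finite support. *)
Lemma p_box_finite_t (M N k n : nat) :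
  finite_set [set t : {ffun 'I_k -> nat} | (0 < p_box M N t n)%N]%classic.
Proof.
apply: (@sub_finite_set _ _
  ((fun s : box_clist M N k => [ffun i => nb_sizes_of_color (cparts s) i])
     @` setT)%classic); last exact: (finite_image _ finite_finset).
by move=> t /= /p_box_gt0[s [_ ->]]; exists s.
Qed.

Lemma p_box_finite_n (M N k : nat) :
  finite_set
    [set n | exists t : {ffun 'I_k -> nat}, (0 < p_box M N t n)%N]%classic.
Proof.
apply: (@sub_finite_set _ _
  ((fun s : box_clist M N k => sumn (unzip1 (cparts s))) @` setT)%classic);
  last exact: (finite_image _ finite_finset).
by move=> n /= [t /p_box_gt0[s [-> _]]]; exists s.
Qed.

(* Main.v *)
(** Both sides enumerate colored partitions in the box: forgetting the colors
    maps them onto the uncolored partitions, and the fiber over a partition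
    [l] consists of the maps from the set of part sizes of [l] to the colors.
    Weighting such a map [f] by the product of the [x_(f a)] and expanding a
    product of sums, the fiber over [l] contributes [(x_1 + ... + x_k)^r],
    where [r] is the number of part sizes of [l]. *)
Require Import Defs.
From mathcomp Require Import all_boot all_order all_algebra.
From mathcomp Require Import boolp classical_sets functions cardinality fsbigop.
From mathcomp Require Import mpoly.
Local Open Scope ring_scope.

Import GRing.Theory.

Set Implicit Arguments.
Unset Strict Implicit.
Unset Printing Implicit Defensive.

(** A value [t] outside the image of [p] has an empty inner sum, so the support is finite. This
    turns the infinite sums over [n] and [t] into sums over the finite type of boxed lists. *)
Lemma fsum_partition (V : nmodType) (S : finType) (T : choiceType)
    (P : pred S) (p : S -> T) (F : S -> V) :
  \sum_(t \in [set: T]%classic) \sum_(s | P s && (p s == t)) F s =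
  \sum_(s | P s) F s.
Proof.
rewrite (fsbigE (undup [seq p s | s <- enum S])) ?undup_uniq //; last first.
  move=> t _; rewrite mem_undup => /mapP tS; apply: big_pred0 => s.
  apply/andP => -[_ /eqP pst]; apply: tS.
  by exists s; rewrite ?mem_enum.
under eq_bigl do rewrite in_setT.
under eq_bigr do rewrite big_mkcondr.
rewrite exchange_big; apply: eq_bigr => s _ /=.
under eq_bigr do rewrite eq_sym.
rewrite -big_mkcond -big_filter filter_pred1_uniq ?undup_uniq ?big_seq1 //.
by rewrite mem_undup map_f ?mem_enum.
Qed.

Lemma nb_sizes_ord (M : nat) (s : seq 'I_M) : nb_sizes (map val s) = #|s|.
Proof.
rewrite /nb_sizes (undup_map_inj val_inj) size_map -(card_uniqP (undup_uniq s)).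
by apply: eq_card => a; rewrite mem_undup.
Qed.

(** The distinct sizes lie among [1..M], since parts are positive, and there are at most [N]
    entries. Hence the range of [r] in the theorem misses no partition. *)
Lemma nb_sizes_le_min (M N : nat) (l : box_list M N) :
  is_partition (parts l) -> (nb_sizes (parts l) <= minn M N)%N.
Proof.
move=> /andP[_ /allP pos]; rewrite leq_min; apply/andP; split; last first.
  by apply: leq_trans (size_undup _) _; rewrite size_map size_bseq.
rewrite -[leqRHS](size_iota 1).
apply: uniq_leq_size (undup_uniq _) _ => a.
rewrite mem_undup mem_iota add1n => al; rewrite (pos a al) /=.
have /mapP[b _ ->] := al; exact: ltn_ord.
Qed.

Section Fiber.
Variables (M N k : nat).
Implicit Types (l : box_list M N) (s : box_clist M N k).

Definition forget_colors s : box_list M N := map_bseq fst s.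

Definition color_with l (f : {ffun 'I_M.+1 -> 'I_k}) : box_clist M N k :=
  map_bseq (fun a => (a, f a)) l.

Lemma unzip1_cparts s : unzip1 (cparts s) = parts (forget_colors s).
Proof. by rewrite /unzip1 /cparts /parts -!map_comp. Qed.

Lemma color_withK l f : forget_colors (color_with l f) = l.
Proof. by apply: val_inj; rewrite /= -map_comp map_id. Qed.

Lemma is_k1_colored_color_with l f :
  is_k1_colored (cparts (color_with l f)) = is_partition (parts l).
Proof.
rewrite /is_k1_colored unzip1_cparts color_withK; case: is_partition => //=.
apply/allrelP => _ _ /mapP[_ /mapP[a _ ->] ->] /mapP[_ /mapP[b _ ->] ->] /=.
by apply/implyP => /eqP/val_inj ->.
Qed.

(** A coloring is a total function, but only its values on the parts of [l] matter; fixing it to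
    [i0] elsewhere makes it unique. *)
Lemma color_with_inj (i0 : 'I_k) l :
  {in pffun_on i0 (mem l) predT &, injective (color_with l)}.
Proof.
move=> f g /pffun_onP[/supportP f0 _] /pffun_onP[/supportP g0 _] /(congr1 val).
move=> /eq_in_map fg; apply/ffunP => a.
have [/fg[] //|al] := boolP (a \in l).
by rewrite f0 ?g0.
Qed.

(** Since equal sizes share a color, the pairs in a colored partition form the graph of a function
    on its part sizes. *)
Lemma fiberE (i0 : 'I_k) l : is_partition (parts l) ->
  [set s | is_k1_colored (cparts s) && (forget_colors s == l)] =
  [set color_with l f | f in pffun_on i0 (mem l) predT].
Proof.
move=> pl; apply/setP => s; rewrite inE; apply/andP/imsetP => [|[f _ ->]]; last first.
  by rewrite is_k1_colored_color_with color_withK.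
move=> [/andP[_ /allrelP fun_s] /eqP <-].
(* The color that [s] attaches to [a], with default [i0] when [a] is not a part, as [pffun_on]
   demands. *)
pose f := [ffun a => odflt i0 [pick i | (a, i) \in (s : seq _)]].
have fE a i : (a, i) \in (s : seq _) -> f a = i.
  move=> ais; rewrite ffunE; case: pickP => [j ajs|/(_ i)]; last by rewrite ais.
  by have /eqP := implyP (fun_s _ _ (map_f _ ajs) (map_f _ ais)) (eqxx _).
exists f.
  apply/pffun_onP; split=> //; apply/supportP => a al; rewrite ffunE.
  case: pickP => // i ais; case/negP: al; exact: (map_f fst ais).
apply: val_inj; rewrite /= -map_comp -[LHS]map_id.
by apply/eq_in_map => -[a i] /fE /= ->.
Qed.

Lemma nb_sizes_of_color_with l f i :
  nb_sizes_of_color (cparts (color_with l f)) i =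
  #|[pred a in l | f a == i]|.
Proof.
rewrite /nb_sizes_of_color /cparts /= !filter_map -!map_comp.
rewrite nb_sizes_ord; apply: eq_card => a.
by rewrite mem_filter inE /= andbC.
Qed.

Variables (R : comNzRingType) (x : 'I_k -> R).

Definition color_weight s := \prod_i x i ^+ nb_sizes_of_color (cparts s) i.

(** Grouping the part sizes [a] by their color [f a] collects the factors into powers of the
    [x i]. *)
Lemma color_weight_color_with l f :
  color_weight (color_with l f) = \prod_(a in l) x (f a).
Proof.
rewrite (partition_big f predT) //=; apply: eq_bigr => i _.
rewrite nb_sizes_of_color_with -prodr_const.
by apply: eq_bigr => a /andP[_ /eqP ->].
Qed.

Lemma sum_fiber (i0 : 'I_k) l : is_partition (parts l) ->
  \sum_(s | is_k1_colored (cparts s) && (forget_colors s == l)) color_weight s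
  = (\sum_i x i) ^+ nb_sizes (parts l).
Proof.
move=> pl; rewrite nb_sizes_ord -prodr_const.
(* The expanded product is indexed by the functions equal to [i0] off [l], exactly those that
   parametrize the fiber in [fiberE]. *)
rewrite (big_distr_big i0) /= -big_set (fiberE i0 pl).
rewrite (big_imset _ (@color_with_inj i0 l)).
by apply: eq_bigr => f _; rewrite color_weight_color_with.
Qed.

End Fiber.

Theorem theorem3 (M N k : nat) (hM : (0 < M)%N) (hN : (0 < N)%N) (hk : (0 < k)%N) :
  \sum_(n \in [set: nat]%classic)
    \sum_(t \in [set: {ffun 'I_k -> nat}]%classic)
      ((p_box M N t n)%:R * \prod_(i < k) 'X_i ^+ t i : {mpoly int[k]}) *: 'X^n
  = \sum_(0 <= r < (minn M N).+1)
      ((\sum_(i < k) 'X_i) ^+ r : {mpoly int[k]}) *: f_box {mpoly int[k]} M N r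
  :> {poly {mpoly int[k]}}.
Proof.
pose x (i : 'I_k) : {mpoly int[k]} := 'X_i.
pose w (s : box_clist M N k) := color_weight x s *: 'X^(sumn (unzip1 (cparts s))).
transitivity (\sum_(s : box_clist M N k | is_k1_colored (cparts s)) w s).
  (* The single sum is split by the value of [n], then by the color counts [t]; on each class [w] is
     constant and [p_box] is the number of terms. *)
  rewrite -(fsum_partition _ (fun s => sumn (unzip1 (cparts s)))).
  apply: eq_fsbigr => n _.
  rewrite -(fsum_partition _ (fun s => [ffun i => nb_sizes_of_color (cparts s) i])).
  apply: eq_fsbigr => t _.
  rewrite /p_box -sumr_const mulr_suml scaler_suml.
  apply: eq_big => s.
    rewrite inE andbA; congr (_ && _); apply/forallP/eqP => [st|<- i].
      by apply/ffunP => i; rewrite ffunE (eqP (st i)).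
    by rewrite ffunE.
  rewrite inE => /and3P[_ /eqP sn /forallP st]; rewrite mul1r /w sn.
  by congr (_ *: _); apply: eq_bigr => i _; rewrite (eqP (st i)).
rewrite (partition_big (@forget_colors M N k) (fun l => is_partition (parts l))) /=; last first.
  by move=> s /andP[]; rewrite unzip1_cparts.
transitivity (\sum_(l : box_list M N | is_partition (parts l))
    (\sum_i x i) ^+ nb_sizes (parts l) *: 'X^(sumn (parts l))).
  (* As [k] is positive, color 0 can serve as the default color. *)
  apply: eq_bigr => l pl; rewrite -(sum_fiber x (Ordinal hk) pl) scaler_suml.
  by apply: eq_bigr => s /andP[_ /eqP sl]; rewrite /w unzip1_cparts sl.
rewrite big_mkord.
(* Grouping by number of part sizes needs a finite index type; [inord] loses nothing here by
   [nb_sizes_le_min]. *)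
rewrite (partition_big (fun l => inord (nb_sizes (parts l))) (fun _ : 'I_(minn M N).+1 => true)) //=.
apply: eq_bigr => r _; rewrite /f_box scaler_sumr.
apply: eq_big => [l|l /andP[pl /eqP <-]]; last first.
  by rewrite inordK // ltnS nb_sizes_le_min.
have [pl|//] := boolP (is_partition _).
by rewrite -val_eqE /= inordK // ltnS nb_sizes_le_min.
Qed.
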